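(* Let $M$ be a finite monoid and let $\mathbf A$ be the pseudovariety of finite aperiodic monoids. Then the maximal $\mathbf A$-stable pairs of $M$ are the maximal pairs $(Y,N)$ such that $Y\in\mathsf{PL}_{\mathbf A}(M)$ and there exists a submonoid $W\le \mathsf{PL}_{\mathbf A}(M)$ such that $W$ is an internal $\mathscr L$-chain and: (1) $\bigcup W=N$; (2) $W\le \mathrm{Stab}(Y)$ (the stabilizer being taken in the monoid $\mathsf{PL}_{\mathbf A}(M)$). Here pairs consisting of a subset and a submonoid of $M$ are ordered by componentwise inclusion, and maximality is with respect to this order.
   Context: A relational morphism $\varphi:M\to N$ of monoids assigns to each $m\in M$ a non-empty subset $m\varphi\subseteq N$ such that $1\in 1\varphi$ and $(m\varphi)(m'\varphi)\subseteq (mm')\varphi$. For $n\in N$, $n\varphi^{-1}=\{m\in M: n\in m\varphi\}$, and for $S\subseteq N$, $S\varphi^{-1}=\bigcup_{n\in S}n\varphi^{-1}$. For a monoid $T$ and $t\in T$, $\mathrm{Stab}(t)=\{t'\in T: tt'=t\}$. Let $\mathbf V$ be a pseudovariety of monoids and $M$ a finite monoid. A subset $Z\subseteq M$ is $\mathbf V$-pointlike if for every relational morphism $\varphi:M\to N$ with $N\in\mathbf V$ there exists $n\in N$ with $Z\subseteq n\varphi^{-1}$. The set $\mathsf{PL}_{\mathbf V}(M)$ of $\mathbf V$-pointlike subsets is a submonoid of the power set monoid $P(M)$ (with product $AB=\{ab: a\in A,b\in B\}$ and identity $\{1\}$). A pair $(Y,U)$ with $Y\subseteq M$ a subset and $U\le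 M$ a submonoid is a $\mathbf V$-stable pair if, for all relational morphisms $\varphi:M\to N$ with $N\in\mathbf V$, there exists $n\in N$ such that $Y\subseteq n\varphi^{-1}$ and $U\le \mathrm{Stab}(n)\varphi^{-1}$. A monoid $W$ is an internal $\mathscr L$-chain if any two elements $a,b\in W$ satisfy $a\in Wb$ or $b\in Wa$ (i.e. the $\mathscr L$-classes of $W$, for the $\mathscr L$-order computed in $W$ itself, form a chain). *)

(* Defs.v *)
From HB Require Import structures.
From mathcomp Require Import all_boot.

Set Implicit Arguments.
Unset Strict Implicit.
Unset Printing Implicit Defensive.

Local Open Scope group_scope.

#[short(type="finMonoidType")]
HB.structure Definition FinMonoid := {M of Monoid M & Finite M}.

Section PowerMonoid.
Variable M : finMonoidType.
Implicit Types A B C : {set M}.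

Definition setmul A B : {set M} := [set a * b | a in A, b in B].

Lemma setmulA : associative setmul.
Proof.
move=> A B C; apply/setP=> x; apply/imset2P/imset2P.
  case=> a y Aa /imset2P[b c Bb Cc ->] ->; exists (a * b) c => //.
    by apply/imset2P; exists a b.
  by rewrite mulgA.
case=> y c /imset2P[a b Aa Bb ->] Cc ->; exists a (b * c) => //.
  by apply/imset2P; exists b c.
by rewrite mulgA.
Qed.

Lemma setmul1 : left_id [set 1] setmul.
Proof.
move=> A; apply/setP=> x; apply/imset2P/idP=> [[_ a /set1P-> Aa ->] | Ax].
  by rewrite mul1g.
by exists 1 x; rewrite ?set11 ?mul1g.
Qed.

Lemma setmulr1 : right_id [set 1] setmul.
Proof.
move=> A; apply/setP=> x; apply/imset2P/idP=> [[a _ Aa /set1P-> ->] | Ax].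
  by rewrite mulg1.
by exists x 1; rewrite ?set11 ?mulg1.
Qed.

HB.instance Definition _ := isMonoid.Build {set M} setmulA setmul1 setmulr1.

End PowerMonoid.

(* [rm_map phi m] is the set written m phi; the morphism axiom uses the product
   of the power monoid {set N}. *)
Record rel_morphism (M N : finMonoidType) := RelMorphism {
  rm_map :> M -> {set N};
  rm_neq0 : forall m, rm_map m != set0;
  rm_one : 1 \in rm_map 1;
  rm_mul : forall m m', rm_map m * rm_map m' \subset rm_map (m * m')
}.

Definition rm_preim (M N : finMonoidType) (phi : rel_morphism M N)
    (S : {set N}) : {set M} :=
  [set m | [exists n in S, n \in phi m]].

Definition stab (T : finMonoidType) (t : T) : {set T} :=
  [set t' | t * t' == t].

Definition aperiodic (N : finMonoidType) : Prop :=
  forall x : N, exists n : nat, x ^+ n.+1 = x ^+ n.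

Section StablePairs.
(* A pseudovariety is given by its class of members. *)
Variables (V : finMonoidType -> Prop) (M : finMonoidType).

Definition pointlike (Z : {set M}) : Prop :=
  forall (N : finMonoidType) (phi : rel_morphism M N), V N ->
    exists n : N, Z \subset rm_preim phi [set n].

Definition stable_pair (p : {set M} * {set M}) : Prop :=
  monoid_closed p.2 /\
  forall (N : finMonoidType) (phi : rel_morphism M N), V N ->
    exists n : N, p.1 \subset rm_preim phi [set n] /\
                  p.2 \subset rm_preim phi (stab n).

End StablePairs.

(* The witness w ranges over W itself: this is the L-order of the monoid W, not
   the one induced from T. *)
Definition internal_Lchain (T : finMonoidType) (W : {set T}) : Prop :=
  forall a b, a \in W -> b \in W ->
    (exists2 w, w \in W & a = w * b) \/ (exists2 w, w \in W & b = w * a).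

(* As W is contained in the submonoid PL_V(M) of {set M}, requiring W to be
   contained in the stabilizer of Y in {set M} or in PL_V(M) is the same. *)
Definition Lchain_pair (V : finMonoidType -> Prop) (M : finMonoidType)
    (p : {set M} * {set M}) : Prop :=
  [/\ monoid_closed p.2,
      pointlike V p.1 &
      exists W : {set {set M}},
        [/\ monoid_closed W,
            forall X, X \in W -> pointlike V X,
            internal_Lchain W,
            \bigcup_(X in W) X = p.2 &
            W \subset stab p.1]].

Definition pair_le (M : finMonoidType) (p q : {set M} * {set M}) : Prop :=
  p.1 \subset q.1 /\ p.2 \subset q.2.

Definition maximal_pair (M : finMonoidType) (P : {set M} * {set M} -> Prop)
    (p : {set M} * {set M}) : Prop :=
  P p /\ forall q, P q -> pair_le p q -> q = p.

(* Main.v *)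
Require Import Defs.
From HB Require Import structures.
From mathcomp Require Import all_boot boolp.

(* If [W] is an L-chain, its principal left ideals are two-sided, so one can
   descend along the idempotents of [W], from [1] to the minimal ideal, and lift
   the elements met on the way to elements of an aperiodic monoid having a common
   fixed point for right multiplication; hence pairs given by L-chains are
   stable.

   Conversely, take a tower of aperiodic quotients of the free monoid on [M],
   each one recording (by a Schützenberger product) the factorizations of a word
   modulo the previous one, with pointlike fibres at the bottom. Taking fibres
   over the inverse limit is then a homomorphism into the pointlike sets. By
   compactness a stable pair lies below the fibre of some limit element [x] and
   the union of the fibres over its stabilizer. This stabilizer is an L-chain:
   factorizing [x u = x v] as words gives [t] with [x t = x] and [v = t u], or the
   same with [u] and [v] exchanged. *)

Set Implicit Arguments.
Unset Strict Implicit.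
Unset Printing Implicit Defensive.

Local Open Scope group_scope.

(** * Idempotent powers and aperiodic monoids *)

Section FiniteMonoids.
Implicit Types N T : finMonoidType.

Lemma expg_idem N (x : N) n : x * x = x -> x ^+ n.+1 = x.
Proof. by move=> xx; elim: n => // n IHn; rewrite expgS IHn. Qed.

Lemma exists_idem_exp N (x : N) : exists2 k, 0 < k & x ^+ k * x ^+ k = x ^+ k.
Proof.
have [i [j [lt_ij eq_ij]]] : exists i j, i < j /\ x ^+ i = x ^+ j.
  have /injectivePn[i [j neq_ij eq_ij]] :
    ~~ injectiveb (fun i : 'I_(#|N|.+1) => x ^+ i).
    by apply/injectiveP => /leq_card; rewrite card_ord ltnn.
  by case: (ltngtP i j) => [ij|ij|/val_inj/eqP]; [exists i, j|exists j, i|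
    rewrite (negPf neq_ij)].
have per1 n : i <= n -> x ^+ (n + (j - i)) = x ^+ n.
  move=> le_in; rewrite -{1}(subnK le_in) -addnA subnKC ?(ltnW lt_ij) //.
  by rewrite expgnDr -eq_ij -expgnDr subnK.
have per m n : i <= n -> x ^+ (n + m * (j - i)) = x ^+ n.
  move=> le_in; elim: m => [|m IHm]; first by rewrite addn0.
  by rewrite mulSn addnCA addnC per1 ?IHm // (leq_trans le_in) ?leq_addr.
(* This exponent is a multiple of the period [j - i], at least [i], and positive even when
   [i = 0]. *)
exists (i.+1 * (j - i))%N; first by rewrite muln_gt0 subn_gt0.
rewrite -expgnDr per //; apply: leq_trans (leqnSn i) _.
by rewrite leq_pmulr ?subn_gt0.
Qed.

Lemma aperiodic_exp N (x : N) n m : x ^+ n.+1 = x ^+ n -> n <= m ->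
  x ^+ m = x ^+ n.
Proof.
move=> xn; elim: m => [|m IHm]; first by rewrite leqn0 => /eqP->.
by rewrite leq_eqVlt => /orP[/eqP<- //|le_nm]; rewrite expgS IHm // -expgS.
Qed.

Lemma aperiodic_idem_exp N (x : N) k : aperiodic N ->
  x ^+ k * x ^+ k = x ^+ k -> 0 < k -> x ^+ k * x = x ^+ k.
Proof.
move=> apN idk k_gt0; have [n xn] := apN x.
have -> : x ^+ k = x ^+ n.
  rewrite -(expg_idem n idk) -expgnA (aperiodic_exp xn) //.
  by rewrite (leq_trans (leqnSn n)) // leq_pmull.
by rewrite -expgSr.
Qed.

(** Iterating gives [x = u ^+ k * x * v ^+ k]; once [u ^+ k.+1 = u ^+ k], one more [u] on the left
    is absorbed. *)
Lemma aperiodic_sandwich N (x u v : N) : aperiodic N -> x = u * x * v -> x = u * x.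
Proof.
move=> apN xE; have [k xk] := apN u.
have xkE n : x = u ^+ n * x * v ^+ n.
  elim: n => [|n IHn]; first by rewrite mul1g mulg1.
  by rewrite expgSr expgS mulgA -(mulgA _ u x) -(mulgA _ (u * x) v) -xE.
by rewrite {2}(xkE k) !mulgA -expgS xk -xkE.
Qed.

(* An element whose principal right ideal inside [S] is minimal spans a
   maximal subgroup of the minimal ideal of [S], trivial by aperiodicity. *)
Lemma aperiodic_min_idem N (S : {set N}) : aperiodic N -> S != set0 ->
  {in S &, forall x y, x * y \in S} ->
  exists2 e, e \in S & forall s, s \in S -> e * s * e = e.
Proof.
move=> apN /set0Pn[s0 Ss0] SM.
pose I (e : N) := [set e * s | s in S].
have [e Se min_e] := arg_minnP (fun e => #|I e|) Ss0.
have eqI x : x \in I e -> I x = I e.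
  case/imsetP=> s Ss ->; apply/eqP; rewrite eqEcard; apply/andP; split.
    by apply/subsetP=> _ /imsetP[t St ->]; apply/imsetP; exists (s * t);
      rewrite ?SM ?mulgA.
  exact/min_e/SM.
have eeI : e * e \in I e by apply: imset_f.
(* [S] need not contain [1], so [e] may lie outside [I e], whereas [e * e] lies in it. *)
exists (e * e); first exact: SM.
move=> s Ss; have : e * e \in I (e * e * s * (e * e)).
  rewrite eqI // -!mulgA; apply: imset_f; rewrite !SM //.
case/imsetP=> t St E; symmetry.
apply: (@trans_eq _ _ (e * e * s * (e * e))) => //.
by apply: (@aperiodic_sandwich N _ _ t) => //; rewrite -E.
Qed.

End FiniteMonoids.

(** * Lifting L-chains to aperiodic monoids *)

Section LChains.
Variables (T : finMonoidType) (W : {set T}).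
Hypotheses (W_closed : monoid_closed W) (W_chain : internal_Lchain W).
Implicit Types a b c d u v w x : T.

Definition leL a b := [exists w in W, a == w * b].

Let W1 : 1 \in W := fst W_closed.
Let WM : {in W &, forall u v, u * v \in W} := snd W_closed.

Let WX w n : w \in W -> w ^+ n \in W.
Proof. by move=> Ww; elim: n => // n IHn; rewrite expgS WM. Qed.

Lemma leLP a b : reflect (exists2 w, w \in W & a = w * b) (leL a b).
Proof.
apply: (iffP existsP) => [[w /andP[Ww /eqP->]]|[w Ww ->]]; first by exists w.
by exists w; rewrite Ww eqxx.
Qed.

Lemma leL_mull w a : w \in W -> leL (w * a) a.
Proof. by move=> Ww; apply/leLP; exists w. Qed.

Lemma leL_refl : reflexive leL.
Proof. by move=> a; apply/leLP; exists 1; rewrite ?mul1g. Qed.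

Lemma leL_trans : transitive leL.
Proof.
move=> b a c /leLP[v Wv ->] /leLP[w Ww ->]; apply/leLP.
by exists (v * w); rewrite ?WM ?mulgA.
Qed.

Lemma leL_mulr2 a b c : leL a b -> leL (a * c) (b * c).
Proof. by move=> /leLP[w Ww ->]; rewrite -mulgA leL_mull. Qed.

Lemma leL_total : {in W &, total leL}.
Proof.
by move=> a b Wa Wb; have [[w Ww E]|[w Ww E]] := W_chain Wa Wb;
  apply/orP; [left|right]; apply/leLP; exists w.
Qed.

(* In a chain, principal left ideals are two-sided: if instead [a] is in
   [W * (a * w)], then [a = u ^+ k * a * w ^+ k] for all [k], and [k] may be
   chosen with [w ^+ k] idempotent. *)
Lemma leL_mulr a w : a \in W -> w \in W -> leL (a * w) a.
Proof.
move=> Wa Ww; have /orP[//|/leLP[u Wu aE]] := leL_total (WM Wa Ww) Wa.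
have aEn n : a = u ^+ n * (a * w ^+ n).
  elim: n => [|n IHn]; first by rewrite mul1g mulg1.
  by rewrite expgSr expgS (mulgA a) -(mulgA _ u) (mulgA u) -aE.
have [[//|k] _ wk] := exists_idem_exp w.
have aw : a * w ^+ k.+1 = a by rewrite {1}(aEn k.+1) -!mulgA wk -aEn.
by rewrite {1}(aEn k) -!mulgA -expgSr aw leL_mull ?WX.
Qed.

Lemma leL_idem a d : d * d = d -> leL a d -> a * d = a.
Proof. by move=> dd /leLP[w _ ->]; rewrite -mulgA dd. Qed.

Lemma leL_expr a n : a \in W -> 0 < n -> leL (a ^+ n) a.
Proof. by case: n => // n Wa _; rewrite expgSr leL_mull ?WX. Qed.

Definition eqL a b := leL a b && leL b a.

(** If [d = u * a = v * b], then [d = d * d = u * (a * v) * b], and [a * v] is a left multiple of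
    [a] because left ideals are two-sided. *)
Lemma eqL_idemM d a b : d \in W -> d * d = d -> a \in W -> b \in W ->
  eqL a d -> eqL b d -> eqL (a * b) d.
Proof.
move=> Wd dd Wa Wb /andP[ad da] /andP[bd db]; apply/andP; split.
  exact: leL_trans (leL_mull _ Wa) bd.
have /leLP[u Wu dE] := da; have /leLP[v Wv dE'] := db.
have /leLP[v' Wv' E] := leL_mulr Wa Wv.
apply/leLP; exists (u * v'); rewrite ?WM // -{1}dd {1}dE {1}dE'.
by rewrite -!mulgA (mulgA a v) E !mulgA.
Qed.

Lemma eqL_idemX d a n : d \in W -> d * d = d -> a \in W -> eqL a d -> 0 < n ->
  eqL (a ^+ n) d.
Proof.
move=> Wd dd Wa ad; case: n => // n _; elim: n => // n IHn.
by rewrite expgS eqL_idemM ?WX.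
Qed.

Section AperiodicImage.
Variables (N : finMonoidType) (Phi : T -> {set N}).
Hypotheses (apN : aperiodic N) (Phi1 : 1 \in Phi 1).
Hypothesis PhiM : forall a b s t, s \in Phi a -> t \in Phi b -> s * t \in Phi (a * b).
Hypothesis Phi0 : forall w, w \in W -> Phi w != set0.
Implicit Types s t e : N.

Let PhiX a s n : s \in Phi a -> s ^+ n \in Phi (a ^+ n).
Proof. by move=> as_; elim: n => // n IHn; rewrite !expgS PhiM. Qed.

(** The goal of the section is a [t] with [fixers t = W]: every element of [W] then lifts into the
    stabilizer of [t]. *)
Definition fixers t := [set w in W | [exists s in Phi w, t * s == t]].

Lemma fixersP t w :
  reflect (w \in W /\ exists2 s, s \in Phi w & t * s = t) (w \in fixers t).
Proof.
rewrite inE; apply: (iffP andP) => [[Ww /existsP[s /andP[? /eqP?]]]|[Ww [s ? E]]].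
  by split=> //; exists s.
by split=> //; apply/existsP; exists s; rewrite E eqxx andbT.
Qed.

Lemma fixersM t v w : v \in fixers t -> w \in fixers t -> v * w \in fixers t.
Proof.
move=> /fixersP[Wv [r vr tr]] /fixersP[Ww [s ws ts]]; apply/fixersP.
by split; [exact: WM|exists (r * s); rewrite ?PhiM ?mulgA ?tr].
Qed.

Lemma fixers_sub t e : e * t = e -> fixers t \subset fixers e.
Proof.
move=> et; apply/subsetP=> w /fixersP[Ww [s ws ts]]; apply/fixersP; split=> //.
by exists s; rewrite // -et -mulgA ts.
Qed.

(** Take [e] in the minimal ideal of the semigroup [S] of those lifts of the L-class of [d] that
    absorb [t] on the right. If [s] lifts some [v] of this class, then [s * e] lifts [v] and lies in
    [S], and [e * (s * e) * e = e] shows that it fixes [e]. *)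
Lemma fix_idem_class d t : d \in W -> d * d = d -> t * t = t -> t \in Phi d ->
  exists c e, [/\ c \in W, c * c = c, e * e = e, e \in Phi c & eqL c d] /\
    fixers t \subset fixers e /\ forall w, w \in W -> eqL w d -> w \in fixers e.
Proof.
move=> Wd dd tt dt.
pose S := [set s | (s * t == s) && [exists w in W, eqL w d && (s \in Phi w)]].
have S_P s : reflect (s * t = s /\ exists w, [/\ w \in W, eqL w d & s \in Phi w])
    (s \in S).
  rewrite inE; apply: (iffP andP) => [[/eqP st /existsP[w /and3P[]]]|].
    by split=> //; exists w.
  by case=> -> [w [Ww wd ws]]; split=> //; apply/existsP; exists w; apply/and3P.
have S0 : S != set0.
  by apply/set0Pn; exists t; apply/S_P; split=> //; exists d; rewrite /eqL leL_refl.
have SM : {in S &, forall s r, s * r \in S}.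
  move=> s r /S_P[st [v [Wv vd vs]]] /S_P[rt [w [Ww wd wr]]]; apply/S_P.
  rewrite -mulgA rt; split=> //; exists (v * w).
  by rewrite WM // eqL_idemM // PhiM.
have [e Se eSe] := aperiodic_min_idem apN S0 SM.
(* [eSe] at [e] gives [e * e * e = e], so [e * e] is idempotent; aperiodicity then gives
   [e * e * e = e * e]. *)
have ee : e * e = e.
  have /(aperiodic_idem_exp apN)-/(_ isT) : (e ^+ 2) * (e ^+ 2) = e ^+ 2.
    by rewrite !expg2 !mulgA eSe.
  by rewrite expg2 eSe.
have /S_P[et [w [Ww wd we]]] := Se.
have [[//|k] k_gt0 wk] := exists_idem_exp w.
have cd : eqL (w ^+ k.+1) d by apply: eqL_idemX.
exists (w ^+ k.+1), e; split.
  by split; rewrite ?WX // -(expg_idem k ee) PhiX.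
split=> [|v Wv vd]; first exact: fixers_sub.
have [s vs] := set0Pn _ (Phi0 Wv).
have vcE : v * w ^+ k.+1 = v.
  apply: leL_idem => //; case/andP: vd cd => vd _ /andP[_]; exact: leL_trans vd.
have se : s * e \in Phi v by rewrite -vcE PhiM // -(expg_idem k ee) PhiX.
apply/fixersP; split=> //; exists (s * e) => //.
have Sse : s * e \in S by apply/S_P; rewrite -mulgA et; split=> //; exists v.
by rewrite -[RHS](eSe _ Sse) -!mulgA ee.
Qed.

Lemma exists_maximal_leL (A : {set T}) : A != set0 -> A \subset W ->
  exists2 w, w \in A & forall v, v \in A -> leL w v -> leL v w.
Proof.
case/set0Pn=> a Aa sAW; pose f a := #|[set x in W | leL x a]|.
have [w Aw max_w] := arg_maxnP f Aa.
exists w => // v Av wv; have := max_w v Av; rewrite /f /=.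
set B := [set x in W | leL x v]; set C := [set x in W | leL x w] => le_BC.
have sCB : C \subset B.
  by apply/subsetP=> x; rewrite !inE => /andP[->] /leL_trans; apply.
have /eqP/setP/(_ v) : C == B by rewrite eqEcard sCB.
by rewrite !inE leL_refl (subsetP sAW).
Qed.

(* Descends along the idempotents [d] of [W], maintaining that [t] is fixed by
   all elements above [d]. *)
Lemma exists_fixed_aux d t : d \in W -> d * d = d -> t * t = t -> t \in Phi d ->
    (forall w, w \in W -> leL d w -> w \in fixers t) ->
  exists c e, [/\ c \in W, e \in Phi c & fixers e = W].
Proof.
have [n] := ubnP #|[set x in W | leL x d]|.
elim: n d t => // n IHn d t le_n Wd dd tt dt fix_t.
have [fixW|] := boolP (W \subset fixers t).
  exists d, t; split=> //; apply/eqP; rewrite eqEsubset fixW andbT.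
  by apply/subsetP=> x /fixersP[].
rewrite -setD_eq0 => WD0.
(* The next idempotent will be a power of [d * w], with [w] L-maximal outside [fixers t]. Such a [w]
   is strictly below [d]. *)
have [w /setDP[Ww not_tw] max_w] := exists_maximal_leL WD0 (subsetDl _ _).
have not_dw : ~~ leL d w by apply: contra not_tw; apply: fix_t.
have wd : leL w d by have /orP[//|/(negP not_dw)] := leL_total Ww Wd.
have wdE : w * d = w by apply: leL_idem.
have [s0 ws0] := set0Pn _ (Phi0 Ww).
have [s ws st] : exists2 s, s \in Phi w & s * t = s.
  by exists (s0 * t); rewrite -?mulgA ?tt // -wdE PhiM.
(* The common exponent keeps [t1] below a lift of [d1]. *)
have [k k_gt0 [dwk tsk]] : exists2 k, 0 < k &
    (d * w) ^+ k * (d * w) ^+ k = (d * w) ^+ k /\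
    (t * s) ^+ k * (t * s) ^+ k = (t * s) ^+ k.
  have [[//|i] _ Ei] := exists_idem_exp (d * w).
  have [[//|j] _ Ej] := exists_idem_exp (t * s).
  exists (i.+1 * j.+1)%N => //.
  split; first by rewrite expgnA (expg_idem j Ei) Ei.
  by rewrite mulnC expgnA (expg_idem i Ej) Ej.
have Wdw : d * w \in W by apply: WM.
set d1 := (d * w) ^+ k in dwk; set t1 := (t * s) ^+ k in tsk.
have Wd1 : d1 \in W by apply: WX.
have dt1 : t1 \in Phi d1 by rewrite PhiX ?PhiM.
have [c [e [[Wc cc ee ce cd1] [fix_e fix_d1]]]] := fix_idem_class Wd1 dwk tsk dt1.
have t1t : t1 * t = t1.
  by rewrite /t1 -(prednK k_gt0) expgSr -!mulgA st.
have sub_e : fixers t \subset fixers e.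
  exact: subset_trans (fixers_sub t1t) fix_e.
(* By aperiodicity [t1 * s = t1 * (t * s) = t1]. *)
have fix_w : w \in fixers e.
  apply: (subsetP fix_e); apply/fixersP; split=> //; exists s => //.
  by rewrite -{1}t1t -mulgA aperiodic_idem_exp.
have d1w : leL d1 w.
  by apply: leL_trans (leL_expr Wdw k_gt0) (leL_mull _ Wd).
have [cd1_ d1c] := andP cd1.
(* The descent is strict: [c] is below [w], hence strictly below [d]. *)
apply: (IHn c e) => //.
  rewrite ltnS in le_n; apply: leq_trans le_n; apply: proper_card; apply/properP; split.
    apply/subsetP=> x; rewrite !inE => /andP[-> xc] /=.
    by apply: leL_trans xc (leL_trans cd1_ (leL_trans d1w wd)).
  exists d; rewrite !inE Wd ?leL_refl //=; apply: contra not_dw => dc.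
  exact: leL_trans dc (leL_trans cd1_ d1w).
(* Otherwise take [u] L-maximal among the elements above [d1] outside [fixers e]. Then [u = v * w],
   and maximality puts [v] below [u], so [u = b ^+ i * u * w ^+ i] for all [i]. As
   [w ^+ k.+1 = w * d1 * d], [u] is also below [d1], hence in its L-class, contradicting
   [fix_d1]. *)
move=> u0 Wu0 cu0; apply/negPn/negP=> not_u0.
pose A := [set u in W :\: fixers e | leL d1 u].
have A0 : A != set0.
  by apply/set0Pn; exists u0; rewrite inE (leL_trans d1c cu0) andbT; apply/setDP.
have sAW : A \subset W by apply/subsetP=> x /setIdP[/setDP[]].
have [u Au max_u] := exists_maximal_leL A0 sAW.
have /setIdP[/setDP[Wu not_u] d1u] := Au.
have uw : leL u w.
  have /orP[//|wu] := leL_total Wu Ww; apply: max_w wu.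
  by apply/setDP; split=> //; apply: contra not_u; apply: (subsetP sub_e).
have /leLP[v Wv uE] := uw.
have vu : leL v u.
  have /orP[//|uv] := leL_total Wv Wu; apply: (max_u) => //.
  rewrite inE (leL_trans d1u uv) andbT; apply/setDP; split=> //.
  by apply: contra not_u => fix_v; rewrite uE fixersM.
have /leLP[b Wb vE] := vu.
have uEi i : u = b ^+ i * u * w ^+ i.
  elim: i => [|i IHk]; first by rewrite mul1g mulg1.
  by rewrite expgSr expgS mulgA -(mulgA _ b u) -(mulgA _ (b * u) w) -vE -uE.
have wX i : w ^+ i.+1 = w * (d * w) ^+ i * d.
  elim: i => [|i IHk]; first by rewrite mulg1 wdE.
  by rewrite expgSr IHk expgSr -!mulgA wdE.
have ud1 : leL u d1.
  rewrite (uEi k.+1) wX !mulgA.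
  apply: leL_trans (leL_mulr Wd1 Wd).
  by rewrite leL_mulr2 // leL_mull // !WM ?WX.
by case/negP: not_u; apply: fix_d1; rewrite // /eqL ud1.
Qed.

Lemma exists_common_fixed :
  exists c e, [/\ c \in W, e \in Phi c & fixers e = W].
Proof.
have [||||c [e [[Wc cc ee ce /andP[_ c1]] [_ fix_e]]]] :=
  @fix_idem_class 1 1; rewrite ?mul1g //.
(* As [c] is in the L-class of [1], so is everything above [c]. *)
apply: (exists_fixed_aux Wc cc ee ce) => w Ww cw; apply: fix_e => //.
by rewrite /eqL (leL_trans c1 cw) andbT -[w]mulg1 leL_mull.
Qed.

End AperiodicImage.
End LChains.

(** * Stability of pairs given by L-chains *)

Section RelationalMorphisms.
Variables (M N : finMonoidType) (phi : rel_morphism M N).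

Lemma in_rm_preim1 n m : (m \in rm_preim phi [set n]) = (n \in phi m).
Proof.
rewrite inE; apply/existsP/idP => [[_ /andP[/set1P-> //]]|nm].
by exists n; rewrite set11.
Qed.

Lemma sub_rm_preim1P n (X : {set M}) :
  reflect (forall m, m \in X -> n \in phi m) (X \subset rm_preim phi [set n]).
Proof.
by apply: (iffP subsetP) => sX m /sX; rewrite in_rm_preim1.
Qed.

Lemma sub_rm_preimM n n' (X X' : {set M}) :
  X \subset rm_preim phi [set n] -> X' \subset rm_preim phi [set n'] ->
  X * X' \subset rm_preim phi [set n * n'].
Proof.
move=> /sub_rm_preim1P sX /sub_rm_preim1P sX'.
apply/sub_rm_preim1P=> _ /imset2P[m m' /sX nm /sX' nm' ->].
by apply: (subsetP (rm_mul phi m m')); apply/imset2P; exists n n'.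
Qed.

End RelationalMorphisms.

(** Pointlikeness makes [Phi] nonempty on [W], which gives a common fixed point [e] lifting some [d]
    in [W]. If the fibre of [y] contains [Y], so does that of [y * e], because [Y * d = Y]; and
    whatever fixes [e] fixes [y * e]. *)
Lemma Lchain_pair_stable (M : finMonoidType) (p : {set M} * {set M}) :
  Lchain_pair aperiodic p -> stable_pair aperiodic p.
Proof.
case: p => Y U [/= U_closed plY [W [W_closed plW W_chain bigW WY]]].
split=> // N phi apN.
pose Phi (X : {set M}) := [set n | X \subset rm_preim phi [set n]].
have [|X X' s t|X WX|d [e [Wd de fix_e]]] :=
    @exists_common_fixed _ W W_closed W_chain N Phi apN.
- rewrite inE; apply/sub_rm_preim1P=> _ /set1P->; exact: rm_one.
- rewrite !inE; exact: sub_rm_preimM.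
- by have [n sXn] := plW X WX N phi apN; apply/set0Pn; exists n; rewrite inE.
have [y sYy] := plY N phi apN.
have fixY X : X \in W -> Y * X = Y.
  by move=> /(subsetP WY); rewrite inE => /eqP.
exists (y * e); split.
  by rewrite /= -(fixY d Wd) sub_rm_preimM //; rewrite inE in de.
rewrite /= -bigW; apply/bigcupsP=> X WX; apply/subsetP=> m Xm.
have /fixersP[_ [s]] : X \in fixers W Phi e by rewrite fix_e.
rewrite inE => /sub_rm_preim1P sX es.
rewrite inE; apply/existsP; exists s; rewrite inE -mulgA es eqxx.
exact: sX.
Qed.

(** * Aperiodic quotients of the free monoid *)

Section Submonoids.
Variables (N : finMonoidType) (S : {set N}).

(** The closure proof is a parameter of the type so that the monoid structure can be inferred from
    it. *)
Definition submonoid of monoid_closed S := {x | x \in S}.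

Variable S_closed : monoid_closed S.
Local Notation sub := (submonoid S_closed).

HB.instance Definition _ := Finite.copy sub {x | x \in S}.
HB.instance Definition _ := SubChoice.copy sub {x | x \in S}.
HB.instance Definition _ :=
  SubChoice_isSubMonoid.Build N [pred x | x \in S] sub S_closed.

Lemma submonoid_aperiodic : aperiodic N -> aperiodic sub.
Proof.
move=> apN x; have [n xn] := apN (val x).
by exists n; apply: val_inj; rewrite !gmulfXn.
Qed.

End Submonoids.

HB.instance Definition _ (N N' : finMonoidType) := Monoid.on (N * N')%type.

Lemma prod_aperiodic (N N' : finMonoidType) :
  aperiodic N -> aperiodic N' -> aperiodic (N * N')%type.
Proof.
move=> apN apN' x; have [n xn] := apN x.1; have [n' xn'] := apN' x.2.
have E k : x ^+ k = (x.1 ^+ k, x.2 ^+ k).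
  by elim: k => // k IHk; rewrite !expgS IHk.
exists (n + n')%N; rewrite !E; congr (_, _).
  by rewrite !(aperiodic_exp xn) ?leq_addr // -addnS leq_addr.
by rewrite !(aperiodic_exp xn') ?leq_addl // -addSn leq_addl.
Qed.

(* The Schützenberger product of [N] with itself: triangular matrices with
   diagonal [n, n] (a single copy suffices) and a set of pairs as upper entry. *)
Section Schutzenberger.
Variable N : finMonoidType.

Definition schutz := (N * {set N * N})%type.
HB.instance Definition _ := Finite.on schutz.

Definition schutz_mul (x y : schutz) : schutz :=
  (x.1 * y.1, [set (q.1, q.2 * y.1) | q in x.2] :|: [set (x.1 * q.1, q.2) | q in y.2]).

Lemma schutz_mulP (x y : schutz) a b :
  reflect ((exists2 c, (a, c) \in x.2 & b = c * y.1) \/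
           (exists2 c, (c, b) \in y.2 & a = x.1 * c))
          ((a, b) \in (schutz_mul x y).2).
Proof.
rewrite inE; apply: (iffP orP).
  case=> /imsetP[[c d] xcd [-> ->]]; first by left; exists d.
  by right; exists c.
case=> [[c xc ->]|[c yc ->]]; [left|right]; apply/imsetP.
  by exists (a, c).
by exists (c, b).
Qed.

Lemma schutz_mulA : associative schutz_mul.
Proof.
move=> x y z; congr (_, _); first exact: mulgA.
apply/setP=> -[a b]; apply/schutz_mulP/schutz_mulP.
  case=> [[c xc ->]|[c /schutz_mulP[[d yd ->]|[d zd ->]] ->]].
  - by left; exists (c * y.1); rewrite ?mulgA //; apply/schutz_mulP; left; exists c.
  - by left; exists d => //; apply/schutz_mulP; right; exists c.
  - by right; exists d; rewrite ?mulgA.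
case=> [[c /schutz_mulP[[d xd ->]|[d yd ->]] ->]|[c zc ->]].
- by left; exists d; rewrite ?mulgA.
- by right; exists d => //; apply/schutz_mulP; left; exists c.
- by right; exists (y.1 * c); rewrite ?mulgA //; apply/schutz_mulP; right; exists c.
Qed.

Lemma schutz_mul1 : left_id (1, set0 : {set N * N}) schutz_mul.
Proof.
case=> n A; congr (_, _); first exact: mul1g.
apply/setP=> -[a b]; apply/(@schutz_mulP (1, set0) (n, A))/idP => /=.
  by case=> [[c]|[c Ac ->]]; rewrite ?inE // mul1g.
by move=> Aab; right; exists a; rewrite ?mul1g.
Qed.

Lemma schutz_mulr1 : right_id (1, set0 : {set N * N}) schutz_mul.
Proof.
case=> n A; congr (_, _); first exact: mulg1.
apply/setP=> -[a b]; apply/(@schutz_mulP (n, A) (1, set0))/idP => /=.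
  by case=> [[c Ac ->]|[c]]; rewrite ?inE // mulg1.
by move=> Aab; left; exists b; rewrite ?mulg1.
Qed.

HB.instance Definition _ :=
  isMonoid.Build schutz schutz_mulA schutz_mul1 schutz_mulr1.

(** The pairs in the upper entry of a power of [x] carry exponents [i] and [j] of [x.1]. If [i + j]
    is at least [p + p], one of them is at least [p] and can be raised by one without effect; if the
    sum is larger, one exceeds [p] and can be lowered. *)
Lemma schutz_aperiodic : aperiodic N -> aperiodic schutz.
Proof.
move=> apN x; have [p xp] := apN x.1.
have x1E k : (x ^+ k).1 = x.1 ^+ k.
  by elim: k => // k IHk; rewrite !expgS -IHk.
have x2P k a b : (a, b) \in (x ^+ k).2 <->
    exists i j c d, [/\ (i + j = k.-1)%N, 0 < k, (c, d) \in x.2,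
      a = x.1 ^+ i * c & b = d * x.1 ^+ j].
  elim: k a b => [|k IHk] a b; first by rewrite inE; split=> // -[? [? [? [? []]]]].
  rewrite expgS; split.
    case/schutz_mulP=> [[c xc ->]|[c /IHk[i [j [c' [d [ij k0 xcd -> ->]]]]] ->]].
      by exists 0, k, a, c; rewrite x1E mul1g.
    exists i.+1, j, c', d; rewrite expgS mulgA; split=> //.
    by rewrite addSn ij prednK.
  case=> i [j [c [d [/= ij _ xcd -> ->]]]]; apply/schutz_mulP.
  case: i ij => [|i] ij.
    by left; exists d; rewrite ?mul1g // x1E -ij.
  right; exists (x.1 ^+ i * c); rewrite ?expgS ?mulgA //.
  by apply/IHk; exists i, j, c, d; split=> //; rewrite -ij.
have xpE i : p <= i -> x.1 ^+ i.+1 = x.1 ^+ i.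
  by move=> pi; rewrite !(aperiodic_exp xp) // (leq_trans pi).
exists (p + p).+1%N; rewrite [LHS]surjective_pairing [RHS]surjective_pairing.
rewrite !x1E; congr (_, _); first by rewrite xpE // -addnS leq_addr.
apply/setP=> -[a b]; apply/idP/idP=> /x2P.
  case=> i [j [c [d [ij _ xcd -> ->]]]]; rewrite /= in ij; apply/x2P.
  case: (leqP i p) => [le_ip|lt_pi].
    case: j ij => [|j] ij; first by move: le_ip; rewrite -(addn0 i) ij ltnNge leq_addr.
    exists i, j, c, d; split=> //; first by apply: succn_inj; rewrite -ij addnS.
    rewrite xpE // -(leq_add2l p); apply: leq_trans (_ : i + j <= _)%N.
      by rewrite -ltnS -ij addnS.
    by rewrite leq_add2r.
  case: i ij lt_pi => // i ij le_pi.
  exists i, j, c, d; split=> //; first by apply: succn_inj; rewrite -ij.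
  by rewrite xpE.
case=> i [j [c [d [ij _ xcd -> ->]]]]; rewrite /= in ij; apply/x2P.
case: (leqP p i) => [le_pi|lt_ip].
  by exists i.+1, j, c, d; split=> //; rewrite ?addSn ?ij // xpE.
exists i, j.+1, c, d; split=> //; first by rewrite addnS ij.
rewrite xpE // -(leq_add2l p) -ij leq_add2r ltnW //.
Qed.

End Schutzenberger.

Section Words.
Variable M : finMonoidType.
Implicit Types u v w : seq M.

Definition weval (N : finMonoidType) (g : M -> N) w : N := \prod_(m <- w) g m.

Lemma weval_nil (N : finMonoidType) (g : M -> N) : weval g [::] = 1.
Proof. exact: big_nil. Qed.

Lemma weval_cons (N : finMonoidType) (g : M -> N) m w :
  weval g (m :: w) = g m * weval g w.
Proof. exact: big_cons. Qed.

Lemma weval_cat (N : finMonoidType) (g : M -> N) v w :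
  weval g (v ++ w) = weval g v * weval g w.
Proof. exact: big_cat. Qed.

(** Surjectivity lets words stand for the elements of the quotient. *)
Record quotient := Quotient {
  quot_monoid : finMonoidType;
  quot_gen : M -> quot_monoid;
  quot_aperiodic : aperiodic quot_monoid;
  quot_surj : forall n, exists w, weval quot_gen w = n
}.

Definition cls (Q : quotient) w := weval (quot_gen Q) w.

Lemma cls_nil Q : cls Q [::] = 1. Proof. exact: weval_nil. Qed.

Lemma cls_cons Q m w : cls Q (m :: w) = quot_gen Q m * cls Q w.
Proof. exact: weval_cons. Qed.

Lemma cls_cat Q v w : cls Q (v ++ w) = cls Q v * cls Q w.
Proof. exact: weval_cat. Qed.

Lemma exists_quotient (N : finMonoidType) (g : M -> N) : aperiodic N ->
  exists Q, forall u v, cls Q u = cls Q v <-> weval g u = weval g v.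
Proof.
move=> apN; pose S := [set n | `[< exists w, weval g w = n >]].
have Sg w : weval g w \in S by rewrite inE; apply/asboolP; exists w.
have S_closed : monoid_closed S.
  split; first by rewrite -(weval_nil g).
  move=> _ _ /[!inE] /asboolP[v <-] /asboolP[w <-]; apply/asboolP.
  by exists (v ++ w); rewrite weval_cat.
have Sg1 m : g m \in S.
  by have := Sg [:: m]; rewrite weval_cons weval_nil mulg1.
pose h m : submonoid S_closed := exist _ (g m) (Sg1 m).
have hE w : val (weval h w) = weval g w.
  by elim: w => [|m w IHw]; rewrite ?weval_nil // !weval_cons valM IHw.
have h_surj n : exists w, weval h w = n.
  have := valP n; rewrite inE => /asboolP[w nE].
  by exists w; apply: val_inj; rewrite hE.
exists (Quotient (submonoid_aperiodic apN) h_surj) => u v.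
by rewrite /cls -!hE; split=> [->|/val_inj].
Qed.

Lemma exists_meet_quotient (N : finMonoidType) (g : M -> N) (Q : quotient) :
  aperiodic N ->
  exists Q', forall u v, cls Q' u = cls Q' v ->
    cls Q u = cls Q v /\ weval g u = weval g v.
Proof.
move=> apN; pose h m : (quot_monoid Q * N)%type := (quot_gen Q m, g m).
have hE w : weval h w = (cls Q w, weval g w).
  elim: w => [|m w IHw]; first by rewrite cls_nil !weval_nil.
  by rewrite cls_cons !weval_cons IHw.
have [Q' Q'P] := exists_quotient h (prod_aperiodic (@quot_aperiodic Q) apN).
by exists Q' => u v /Q'P; rewrite !hE => -[].
Qed.

(** The second clause makes fibres multiplicative in the limit of a tower; the third isolates the
    empty word, so that its limit fibre is the identity of the power monoid. *)
Definition splits (Q Q' : quotient) :=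
  [/\ forall u v, cls Q' u = cls Q' v -> cls Q u = cls Q v,
      forall u1 u2 v, cls Q' (u1 ++ u2) = cls Q' v ->
        exists v1 v2, [/\ v = v1 ++ v2, cls Q u1 = cls Q v1 & cls Q u2 = cls Q v2]
    & forall v, cls Q' [::] = cls Q' v -> v = [::]].

(** With [h], the upper entry of the matrix of a word collects the pairs of classes of its
    factorizations, so words with equal matrices have matching factorizations. *)
Lemma exists_splits (Q : quotient) : exists Q', splits Q Q'.
Proof.
pose N := quot_monoid Q.
pose h m : schutz N := (quot_gen Q m, [set (1, quot_gen Q m)]).
have h1 w : (weval h w).1 = cls Q w.
  by elim: w => [|m w IHw]; rewrite ?weval_nil ?cls_nil // weval_cons cls_cons -IHw.
(* The second factor is required to be nonempty so that the empty word is sent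
   to the identity. *)
have h2P w a b : (a, b) \in (weval h w).2 <-> exists w1 w2,
    [/\ w = w1 ++ w2, w2 <> [::], cls Q w1 = a & cls Q w2 = b].
  elim: w a b => [|m w IHw] a b.
    by rewrite weval_nil inE; split=> // -[[|? ?] [[|? ?] []]].
  rewrite weval_cons; split.
    case/schutz_mulP=> [[c]|[c]].
      rewrite inE => /eqP[-> ->] ->; exists [::], (m :: w).
      by rewrite cls_nil cls_cons h1; split.
    case/IHw=> w1 [w2 [-> w20 <- <-]] ->.
    by exists (m :: w1), w2; rewrite cls_cons.
  case=> -[|m' w1] [w2 [wE w20 <- <-]]; apply/schutz_mulP.
    left; exists (quot_gen Q m); rewrite ?inE ?cls_nil //.
    by rewrite -[w2]/([::] ++ w2) -wE cls_cons h1.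
  case: wE => -> wE; right; exists (cls Q w1); last by rewrite cls_cons.
  by apply/IHw; exists w1, w2.
have [Q' Q'P] := exists_quotient h (schutz_aperiodic (@quot_aperiodic Q)).
exists Q'; split=> [u v /Q'P E|u1 [|m u2] v /Q'P E|v /Q'P E].
- by rewrite -!h1 E.
(* The factorization with empty second factor is read off the diagonal. *)
- by exists v, [::]; rewrite cats0 -(h1 v) -E h1 cats0.
- have /h2P[v1 [v2 [vE _ <- <-]]] :
      (cls Q u1, cls Q (m :: u2)) \in (weval h v).2.
    by rewrite -E; apply/h2P; exists u1, (m :: u2).
  by exists v1, v2.
case: v E => // m v E.
have /h2P[[|? ?] [[|? ?] []]] // :
    (cls Q [::], cls Q (m :: v)) \in (weval h [::]).2.
by rewrite E; apply/h2P; exists [::], (m :: v).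
Qed.

End Words.

(** * Fibres of the quotients in [M] *)

Section Fibres.
Variable M : finMonoidType.
Implicit Types (Q : quotient M) (u v w : seq M).

(** This is the preimage of the class of [u] under the relational morphism sending [m] to the
    classes of the words of value [m]. *)
Definition fibre Q u : {set M} :=
  [set m | `[< exists2 v, cls Q v = cls Q u & weval id v = m >]].

Lemma fibreP Q u m :
  reflect (exists2 v, cls Q v = cls Q u & weval id v = m) (m \in fibre Q u).
Proof. by rewrite inE; apply: asboolP. Qed.

Lemma fibre_eq Q u v : cls Q u = cls Q v -> fibre Q u = fibre Q v.
Proof. by move=> E; apply/setP=> m; rewrite !inE E. Qed.

Lemma fibreM_sub Q u v : fibre Q u * fibre Q v \subset fibre Q (u ++ v).
Proof.
apply/subsetP=> _ /imset2P[_ _ /fibreP[a au <-] /fibreP[b bv <-] ->].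
by apply/fibreP; exists (a ++ b); rewrite ?weval_cat // !cls_cat au bv.
Qed.

(** This is the converse of [fibreM_sub], at the cost of one level of the tower. *)
Lemma fibre_splits Q Q' u v : splits Q Q' ->
  fibre Q' (u ++ v) \subset fibre Q u * fibre Q v.
Proof.
case=> _ Q'M _; apply/subsetP=> _ /fibreP[w wE <-].
have [a [b [-> ua vb]]] := Q'M _ _ _ (esym wE); rewrite weval_cat.
apply/imset2P; exists (weval id a) (weval id b) => //; apply/fibreP.
  by exists a.
by exists b.
Qed.

Lemma fibre_rel_morphism (N : finMonoidType) (phi : rel_morphism M N)
  (g : M -> N) w : (forall m, g m \in phi m) -> weval g w \in phi (weval id w).
Proof.
move=> g_phi; elim: w => [|m w IHw]; first by rewrite !weval_nil rm_one.
rewrite !weval_cons; apply: (subsetP (rm_mul phi m (weval id w))).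
by apply/imset2P; exists (g m) (weval g w).
Qed.

Lemma pointlike_sub V (X Y : {set M}) : X \subset Y -> pointlike V Y -> pointlike V X.
Proof.
move=> sXY plY N phi VN; have [n sYn] := plY N phi VN.
by exists n; apply: subset_trans sYn.
Qed.

(** [M] has finitely many subsets, and each one that is not pointlike is excluded by some relational
    morphism to an aperiodic monoid. Choosing an image of each letter there gives a map [g], by
    which the quotient is refined. *)
Lemma exists_pointlike_quotient :
  exists Q, forall u, pointlike aperiodic (fibre Q u).
Proof.
suff [Q QP] : exists Q, forall Z, Z \in enum {set M} ->
    forall u, Z \subset fibre Q u -> pointlike aperiodic Z.
  by exists Q => u; apply: (QP _ _ u); rewrite ?mem_enum.
elim: (enum _) => [|Z s [Q QP]].
  have cl1 : monoid_closed [set (1 : M)].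
    by split=> [|x y /set1P-> /set1P->]; rewrite !inE ?mulg1.
  have ap1 : aperiodic (submonoid cl1).
    move=> x; exists 0; apply: val_inj; rewrite expg1 expg0 val1.
    exact/set1P/(valP x).
  by have [Q _] := exists_quotient (fun _ : M => 1) ap1; exists Q.
have [plZ|] := pselect (pointlike aperiodic Z).
  by exists Q => Z' /[!inE] /predU1P[-> //|/QP].
move=> /existsNP[N /existsNP[phi /not_implyP[apN /forallNP nZ]]].
pose g m := xchoose (set0Pn _ (rm_neq0 phi m)).
have g_phi m : g m \in phi m := xchooseP (set0Pn _ (rm_neq0 phi m)).
have [Q' Q'P] := exists_meet_quotient g Q apN.
exists Q' => Z' /[!inE] /predU1P[-> u sZ|sZ' u sZ'u].
  case: (nZ (weval g u)); apply/sub_rm_preim1P=> m /(subsetP sZ).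
  by case/fibreP=> v /Q'P[_ <-] <-; apply: fibre_rel_morphism.
apply: (QP _ sZ' u); apply: subset_trans sZ'u _; apply/subsetP=> m.
by case/fibreP=> v /Q'P[vu _] vm; apply/fibreP; exists v.
Qed.

Lemma stable_pair_quotient (Q : quotient M) (p : {set M} * {set M}) :
  stable_pair aperiodic p -> exists x, p.1 \subset fibre Q x /\
    forall m, m \in p.2 -> exists2 u, weval id u = m & cls Q (x ++ u) = cls Q x.
Proof.
case=> _ stab_p.
pose phi m := [set n | `[< exists2 w, weval id w = m & cls Q w = n >]].
have phiP m n : reflect (exists2 w, weval id w = m & cls Q w = n) (n \in phi m).
  by rewrite inE; apply: asboolP.
have phi0 m : phi m != set0.
  apply/set0Pn; exists (cls Q [:: m]); apply/phiP; exists [:: m] => //.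
  by rewrite weval_cons weval_nil mulg1.
have phi1 : 1 \in phi 1 by apply/phiP; exists [::]; rewrite ?weval_nil ?cls_nil.
have phiM m m' : phi m * phi m' \subset phi (m * m').
  apply/subsetP=> _ /imset2P[_ _ /phiP[w <- <-] /phiP[w' <- <-] ->].
  by apply/phiP; exists (w ++ w'); rewrite ?weval_cat ?cls_cat.
have [n []] := stab_p _ (RelMorphism phi0 phi1 phiM) (@quot_aperiodic _ Q).
have [x xn] : exists x, cls Q x = n := quot_surj n.
move=> /sub_rm_preim1P sY /subsetP sU; exists x; split.
  apply/subsetP=> m /sY /phiP[w wm wn]; apply/fibreP; exists w => //.
  by rewrite wn -xn.
move=> m /sU; rewrite inE => /existsP[s /andP[]].
rewrite inE => /eqP ns /phiP[w wm ws]; exists w => //.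
by rewrite cls_cat ws xn.
Qed.

End Fibres.

(** This is Levi's lemma for free monoids. *)
Lemma cat_equidivisible (A : Type) (a b c d : seq A) : a ++ b = c ++ d ->
  exists t, (c = a ++ t /\ b = t ++ d) \/ (a = c ++ t /\ d = t ++ b).
Proof.
elim: a c => [|x a IHa] [|y c] /= E; first by exists [::]; left.
- by exists (y :: c); left.
- by exists (x :: a); right.
case: E => -> /IHa[t [[-> ->]|[-> ->]]]; exists t; [left|right]; by [].
Qed.

(** * Inverse limits *)

Section Towers.
Variables (M : finMonoidType) (Q : nat -> quotient M).
Hypothesis Q_splits : forall k, splits (Q k) (Q k.+1).
Implicit Types (w : seq M) (u v x : nat -> seq M).

Lemma cls_le j k w w' : j <= k -> cls (Q k) w = cls (Q k) w' ->
  cls (Q j) w = cls (Q j) w'.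
Proof.
elim: k => [|k IHk]; first by rewrite leqn0 => /eqP->.
rewrite leq_eqVlt => /predU1P[-> //|le_jk] E; apply: IHk => //.
by have [+ _ _] := Q_splits k; apply.
Qed.

(* Coherent sequences of words stand for the elements of the inverse limit of
   the tower. *)
Definition coherent u := forall k, cls (Q k) (u k.+1) = cls (Q k) (u k).

Lemma coherent_le u j k : coherent u -> j <= k -> cls (Q j) (u k) = cls (Q j) (u j).
Proof.
move=> cu; elim: k => [|k IHk]; first by rewrite leqn0 => /eqP->.
rewrite leq_eqVlt ltnS => /predU1P[-> //|le_jk]; rewrite -IHk //.
exact: (cls_le le_jk (cu k)).
Qed.

Lemma coherent_cat u v : coherent u -> coherent v -> coherent (fun k => u k ++ v k).
Proof. by move=> cu cv k; rewrite !cls_cat cu cv. Qed.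

Section Koenig.
Variable P : nat -> seq M -> Prop.
Hypothesis P_decr : forall k w, P k.+1 w -> P k w.

(** There are finitely many classes modulo [Q i]. If each missed [P] from some level on, [P] would
    be empty at the largest of these levels. *)
Lemma exists_live_class i : (forall k, exists w, P k w) ->
  exists w, forall k, exists2 w', P k w' & cls (Q i) w' = cls (Q i) w.
Proof.
move=> P_ex; apply: contrapT => /forallNP no_live.
have P_le j k w : j <= k -> P k w -> P j w.
  elim: k => [|k IHk]; first by rewrite leqn0 => /eqP->.
  by rewrite leq_eqVlt => /predU1P[-> //|le_jk] /P_decr; apply: IHk.
have dead c : exists k, forall w, P k w -> cls (Q i) w <> c.
  have [w <-] : exists w, cls (Q i) w = c := quot_surj c.
  have /existsNP[k /forall2NP no_k] := no_live w; exists k => w' Pw'.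
  by have [] := no_k w'.
have [f fP] := choice dead.
have [w Pw] := P_ex (\max_c f c).
by apply: (fP (cls (Q i) w) w) => //; apply: P_le Pw; apply: leq_bigmax.
Qed.

End Koenig.

Lemma koenig (P : nat -> seq M -> Prop) :
  (forall k w, P k.+1 w -> P k w) ->
  (forall k w w', cls (Q k) w = cls (Q k) w' -> P k w -> P k w') ->
  (forall k, exists w, P k w) -> exists2 u, coherent u & forall k, P k (u k).
Proof.
move=> P_decr P_inv P_ex.
pose live i w := forall k, exists2 w', P k w' & cls (Q i) w' = cls (Q i) w.
have [w0 live0] : exists w, live 0 w by apply: exists_live_class.
have next i (w : {w | live i w}) :
    {w' | live i.+1 w' & cls (Q i) w' = cls (Q i) (sval w)}.
  apply: cid2; case: w => w live_w /=.
  (* [P] is restricted to the class of [w], so that the new live class refines the old one. *)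
  have [|k|w' live_w'] := @exists_live_class
    (fun k w' => P k w' /\ cls (Q i) w' = cls (Q i) w) _ i.+1.
  - by move=> k w' [/P_decr].
  - by have [w' ? ?] := live_w k; exists w'.
  exists w' => [k|]; first by have [v [? _] ?] := live_w' k; exists v.
  have [v [_ <-] /esym] := live_w' 0; exact: cls_le.
pose F : forall i, {w | live i w} :=
  nat_rect (fun i => {w | live i w}) (exist _ w0 live0)
    (fun i (w : {w | live i w}) => exist _ (s2val (next i w)) (s2valP (next i w))).
exists (fun i => sval (F i)) => k; first exact: (s2valP' (next k (F k))).
by have [w Pw wF] := svalP (F k) k; apply: P_inv wF Pw.
Qed.

Definition lim_fibre u : {set M} :=
  [set m | `[< forall k, m \in fibre (Q k) (u k) >]].

Lemma lim_fibre_sub u k : lim_fibre u \subset fibre (Q k) (u k).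
Proof. by apply/subsetP=> m; rewrite inE => /asboolP. Qed.

Lemma fibre_le u j k : coherent u -> j <= k ->
  fibre (Q k) (u k) \subset fibre (Q j) (u j).
Proof.
move=> cu le_jk; apply/subsetP=> m /fibreP[w wu wm]; apply/fibreP; exists w => //.
by rewrite (cls_le le_jk wu) coherent_le.
Qed.

(** Each [m] outside the limit is excluded at some level; as [M] is finite and fibres decrease, one
    level serves for all. *)
Lemma lim_fibre_stabilises u : coherent u ->
  exists K, forall k, K <= k -> fibre (Q k) (u k) = lim_fibre u.
Proof.
move=> cu.
have out m : exists j, m \notin lim_fibre u -> m \notin fibre (Q j) (u j).
  have [lu|] := boolP (m \in lim_fibre u); first by exists 0.
  rewrite inE => /asboolPn/existsNP[j /negP not_m]; by exists j.
have [f fP] := choice out.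
exists (\max_m f m) => k le_k; apply/eqP; rewrite eqEsubset lim_fibre_sub andbT.
apply/subsetP=> m mk; apply: contraLR mk => /fP; apply: contra.
apply: (subsetP (fibre_le cu _)); apply: leq_trans le_k; exact: leq_bigmax.
Qed.

Lemma lim_fibreM u v : coherent u -> coherent v ->
  lim_fibre (fun k => u k ++ v k) = lim_fibre u * lim_fibre v.
Proof.
move=> cu cv; have cuv := coherent_cat cu cv.
have [i iE] := lim_fibre_stabilises cu; have [j jE] := lim_fibre_stabilises cv.
have [l lE] := lim_fibre_stabilises cuv.
pose k := (i + j + l)%N.
have ik : i <= k by rewrite /k -addnA leq_addr.
have jk : j <= k by rewrite /k addnAC leq_addl.
have lk : l <= k by rewrite /k leq_addl.
(* At a level where all three fibres are stable, [fibreM_sub] gives one inclusion and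
   [fibre_splits], from level [k.+1] to [k], the other. *)
apply/eqP; rewrite eqEsubset -{1}(lE k.+1) ?(leq_trans lk) //.
rewrite -(iE k) // -(jE k) // -(lE k) // fibreM_sub andbT.
apply: subset_trans (fibre_splits _ _ (Q_splits k)) _.
by rewrite -(fibre_eq (cu k)) -(fibre_eq (cv k)).
Qed.

Lemma lim_fibre_nil : lim_fibre (fun=> [::]) = 1.
Proof.
apply/setP=> m; rewrite !inE; apply/asboolP/eqP => [/(_ 1%N)/fibreP[w wE <-]|-> k].
  by have [_ _ /(_ _ (esym wE)) ->] := Q_splits 0; rewrite weval_nil.
by apply/fibreP; exists [::]; rewrite ?weval_nil.
Qed.

Lemma lim_fibre_eq u v : (forall k, cls (Q k) (u k) = cls (Q k) (v k)) ->
  lim_fibre u = lim_fibre v.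
Proof.
move=> E; apply/setP=> m; rewrite !inE.
by congr `[< _ >]; apply/propext; split=> mk k; have := mk k;
  rewrite (fibre_eq (E k)).
Qed.

Definition stabilises x u :=
  coherent u /\ forall k, cls (Q k) (x k ++ u k) = cls (Q k) (x k).

Lemma stabilises_cat x u v : stabilises x u -> stabilises x v ->
  stabilises x (fun k => u k ++ v k).
Proof.
move=> [cu xu] [cv xv]; split; first exact: coherent_cat.
by move=> k; rewrite catA cls_cat xu -cls_cat xv.
Qed.

(* Equidivisibility of words: of two prefixes of a word, one extends the other. *)
Lemma exists_transfer x u v : coherent x -> stabilises x u -> stabilises x v ->
  (exists2 t, stabilises x t &
    forall k, cls (Q k) (t k ++ u k) = cls (Q k) (v k)) \/
  (exists2 t, stabilises x t &
    forall k, cls (Q k) (t k ++ v k) = cls (Q k) (u k)).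
Proof.
move=> cx xu xv.
pose P u v k t := cls (Q k) (x k ++ t) = cls (Q k) (x k) /\
  cls (Q k) (t ++ u k) = cls (Q k) (v k).
have P_limit y z : stabilises x y -> stabilises x z ->
    (forall k, exists t, P y z k t) ->
    exists2 t, stabilises x t & forall k, cls (Q k) (t k ++ y k) = cls (Q k) (z k).
  move=> [cy _] [cz _] P_ex.
  have [k t [E1 E2]|k t t' tt' [E1 E2]|//|t ct Pt] := @koenig (P y z).
  - split.
      by move: (cls_le (leqnSn k) E1); rewrite !cls_cat (cx k).
    by move: (cls_le (leqnSn k) E2); rewrite !cls_cat (cy k) (cz k).
  - by split; [rewrite -E1|rewrite -E2]; rewrite !cls_cat tt'.
  by exists t => [|k]; [split=> // k|]; case: (Pt k).
have P_or k : (exists t, P u v k t) \/ (exists t, P v u k t).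
  have [[cu ux] [cv vx]] := (xu, xv); have [_ Qk _] := Q_splits k.
  (* At level [k.+1], [x u] and [x v] have the same class, so the factorization of the former
     transfers to the word [x v], with classes compared at level [k]. Levi's lemma then compares it
     with the factorization of [x v] itself. *)
  have [a [b [xvE xa ub]]] : exists a b, [/\ x k.+1 ++ v k.+1 = a ++ b,
      cls (Q k) (x k.+1) = cls (Q k) a & cls (Q k) (u k.+1) = cls (Q k) b].
    by apply: Qk; rewrite ux vx.
  rewrite (cx k) in xa; rewrite (cu k) in ub.
  have [t [[aE vE]|[xE bE]]] := cat_equidivisible xvE; [left|right]; exists t.
    by split; rewrite ?cls_cat ?ub -?(cx k) -?(cv k) ?vE -cls_cat -?aE ?cx.
  by split; [rewrite cls_cat xa -cls_cat -xE cx|rewrite cls_cat -(cv k) -cls_cat -bE].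
(* If the first alternative fails at [k0], the second holds at every [k]: at level [k + k0] the
   first would descend to [k0]. *)
have [Puv|/existsNP[k0 nPuv]] := pselect (forall k, exists t, P u v k t).
  by left; apply: P_limit.
right; apply: P_limit => // k.
have P_decr y z j i t : coherent y -> coherent z -> i <= j -> P y z j t -> P y z i t.
  move=> cy cz le_ij [E1 E2]; split.
    by move: (cls_le le_ij E1); rewrite !cls_cat (coherent_le cx le_ij).
  move: (cls_le le_ij E2); rewrite !cls_cat.
  by rewrite (coherent_le cy le_ij) (coherent_le cz le_ij).
have [[cu _] [cv _]] := (xu, xv).
have [[t Pt]|[t Pt]] := P_or (k + k0)%N.
  by case: nPuv; exists t; apply: P_decr Pt; rewrite ?leq_addl.
by exists t; apply: P_decr Pt; rewrite ?leq_addr.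
Qed.

Lemma exists_Lchain_pair_ge (p : {set M} * {set M}) :
  (forall w, pointlike aperiodic (fibre (Q 0) w)) ->
  stable_pair aperiodic p -> exists2 q, Lchain_pair aperiodic q & pair_le p q.
Proof.
move=> pl0 stab_p.
have pl_lim u : pointlike aperiodic (lim_fibre u).
  exact: pointlike_sub (lim_fibre_sub u 0) (pl0 _).
pose P k w := p.1 \subset fibre (Q k) w /\
  forall m, m \in p.2 ->
    exists2 w', weval id w' = m & cls (Q k) (w ++ w') = cls (Q k) w.
have [k w [sY sU]|k w w' ww' [sY sU]|k|x cx Px] := @koenig P.
- split=> [|m /sU[w' wm ww']]; last by exists w' => //; apply: cls_le ww'.
  apply: subset_trans sY _; apply/subsetP=> m /fibreP[w' ww' wm].
  by apply/fibreP; exists w' => //; apply: cls_le ww'.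
- split=> [|m /sU[w1 wm ww1]]; first by rewrite -(fibre_eq ww').
  by exists w1 => //; rewrite cls_cat -ww' -cls_cat.
- exact: stable_pair_quotient.
pose W : {set {set M}} := [set X | `[< exists2 u, stabilises x u & X = lim_fibre u >]].
have WP X : reflect (exists2 u, stabilises x u & X = lim_fibre u) (X \in W).
  by rewrite inE; apply: asboolP.
have W_closed : monoid_closed W.
  split=> [|_ _ /WP[u xu ->] /WP[v xv ->]]; apply/WP.
    exists (fun=> [::]); last by rewrite lim_fibre_nil.
    by split=> // k; rewrite cats0.
  exists (fun k => u k ++ v k); first exact: stabilises_cat.
  by case: xu xv => [cu _] [cv _]; rewrite lim_fibreM.
have bigWP m : reflect (exists2 X, X \in W & m \in X) (m \in \bigcup_(X in W) X).
  by apply: (iffP bigcupP) => -[X]; exists X.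
exists (lim_fibre x, \bigcup_(X in W) X).
  split=> //=.
    split=> [|m m' /bigWP[X WX Xm] /bigWP[X' WX' Xm']]; apply/bigWP.
      by exists 1; [case: W_closed|rewrite inE].
    exists (X * X'); first by case: W_closed => _; apply.
    by apply/imset2P; exists m m'.
  exists W; split=> //.
  - by move=> _ /WP[u _ ->].
  - move=> _ _ /WP[u xu ->] /WP[v xv ->].
    have [[t xt tE]|[t xt tE]] := exists_transfer cx xu xv; [right|left];
      exists (lim_fibre t); try (by apply/WP; exists t);
      case: xu xv xt => [cu _] [cv _] [ct _].
      by rewrite -(lim_fibreM ct cu) (lim_fibre_eq tE).
    by rewrite -(lim_fibreM ct cv) (lim_fibre_eq tE).
  apply/subsetP=> _ /WP[u [cu xu] ->]; rewrite inE -lim_fibreM //.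
  exact/eqP/lim_fibre_eq.
split=> /=.
  apply/subsetP=> m Ym; rewrite inE; apply/asboolP=> k.
  by case: (Px k) => /subsetP sY _; apply: sY.
apply/subsetP=> m Um.
(* The word over [m] stabilising [x] depends on the level; compactness makes a coherent choice. *)
have [k w [wm xw]|k w w' ww' [wm xw]|k|u cu Pu] := @koenig
  (fun k w => m \in fibre (Q k) w /\ cls (Q k) (x k ++ w) = cls (Q k) (x k)).
- split.
    have /fibreP[w' ww' w'm] := wm.
    by apply/fibreP; exists w' => //; apply: cls_le ww'.
  by move: (cls_le (leqnSn k) xw); rewrite !cls_cat cx.
- by split; [rewrite -(fibre_eq ww')|rewrite cls_cat -ww' -cls_cat].
- have [_ /(_ m Um)[w wm xw]] := Px k.
  by exists w; split=> //; apply/fibreP; exists w.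
apply/bigWP; exists (lim_fibre u).
  by apply/WP; exists u => //; split=> // k; case: (Pu k).
by rewrite inE; apply/asboolP=> k; case: (Pu k).
Qed.

End Towers.

(** * Comparison of maximal pairs *)

Lemma stable_pair_le_Lchain (M : finMonoidType) (p : {set M} * {set M}) :
  stable_pair aperiodic p -> exists2 q, Lchain_pair aperiodic q & pair_le p q.
Proof.
move=> stab_p; have [Q0 pl0] := exists_pointlike_quotient M.
have [next nextP] := choice (@exists_splits M).
by apply: (@exists_Lchain_pair_ge M (fun k => iter k next Q0)) => [k|//|//].
Qed.

Theorem theorem6p4 (M : finMonoidType) (p : {set M} * {set M}) :
  maximal_pair (@stable_pair aperiodic M) p <->
  maximal_pair (@Lchain_pair aperiodic M) p.
Proof.
have le_trans (q r s : {set M} * {set M}) : pair_le q r -> pair_le r s -> pair_le q s.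
  by case=> q1 q2 [r1 r2]; split; [apply: subset_trans r1|apply: subset_trans r2].
have le_anti (q r : {set M} * {set M}) : pair_le q r -> pair_le r q -> q = r.
  case: q r => [q1 q2] [r1 r2] [/= qr1 qr2] [/= rq1 rq2].
  by congr (_, _); apply/eqP; rewrite eqEsubset ?qr1 ?qr2.
(* L-chain pairs are stable and every stable pair lies below one of them; families so related have
   the same maximal elements. *)
split=> -[Pp max_p]; split.
- have [q Lq le_pq] := stable_pair_le_Lchain Pp.
  by rewrite -(max_p q) //; apply: Lchain_pair_stable.
- by move=> q Lq; apply: max_p; apply: Lchain_pair_stable.
- exact: Lchain_pair_stable.
move=> q stab_q le_pq; have [r Lr le_qr] := stable_pair_le_Lchain stab_q.
by apply: le_anti => //; rewrite -(max_p r Lr (le_trans _ _ _ le_pq le_qr)).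
Qed.
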